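(* Let $d,m \in \mathbb{N}$, $s \in \{1,\dots,d\}$, and $M := 8 \lceil m^{1/s} \rceil$. Assume that $U \subset C([0,1]^d)$ satisfies \[ u_0 + \nu \cdot \frac{\lambda}{M s} \vartheta^{(s)}_{M,y} \in U \qquad \text{for all } \nu \in \{ \pm 1 \} \text{ and } y \in [0,1]^d \] for some $\lambda > 0$ and $u_0 \in C([0,1]^d)$. Then \[ \mathrm{err}_m^{MC} (U, L^p([0,1]^d)) \geq \frac{\lambda / 2}{(64 s)^{1 + \frac{s}{p}}} \cdot m^{-\frac{1}{p} - \frac{1}{s}} \qquad \text{for all } p \in [1,\infty]. \]
   Context: Let $\varrho(x)=\max\{0,x\}$. For $M>0$, $\sigma\in\mathbb{R}$: $\Lambda_{M,\sigma}(t)=0$ if $t\le\sigma-\frac1M$, and $\Lambda_{M,\sigma}(t)=1-M|t-\sigma|$ if $t\ge\sigma-\frac1M$. For $y\in\mathbb{R}^d$, $s\in\{1,\dots,d\}$: $\vartheta^{(s)}_{M,y}(x)=\varrho\big(\sum_{i=1}^s\Lambda_{M,y_i}(x_i)-(s-1)\big)$, $x\in\mathbb{R}^d$. For $p=\infty$, $1/p=s/p=0$. Algorithms: for a Banach space $Y$ and $U\subset C([0,1]^d)\cap Y$, $A:U\to Y$ is an adaptive deterministic method using $m$ point samples if there are $f_1\in[0,1]^d$, maps $f_i:([0,1]^d)^{i-1}\times\mathbb{R}^{i-1}\to[0,1]^d$ ($2\le i\le m$) and $Q:([0,1]^d)^m\times\mathbb{R}^m\to Y$ such that for all $u\in U$,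 with $x_1=f_1$, $x_i=f_i(x_1,\dots,x_{i-1},u(x_1),\dots,u(x_{i-1}))$, $A(u)=Q(x_1,\dots,x_m,u(x_1),\dots,u(x_m))$; these form $\mathrm{Alg}_m(U,Y)$. An adaptive random method using $m$ samples on average is $(\mathbf{A},\mathbf{m})$ with $\mathbf{A}=(A_\omega)_{\omega\in\Omega}$ over a probability space $(\Omega,\mathcal{F},\mathbb{P})$, $\mathbf{m}:\Omega\to\mathbb{N}$ measurable with $\mathbb{E}[\mathbf{m}]\le m$, $\omega\mapsto A_\omega(u)$ Borel measurable for each $u\in U$, and $A_\omega\in\mathrm{Alg}_{\mathbf{m}(\omega)}(U,Y)$ for all $\omega$; these form $\mathrm{Alg}^{MC}_m(U,Y)$. Define $\mathrm{err}^{MC}_m(U,Y)=\inf_{(\mathbf{A},\mathbf{m})\in\mathrm{Alg}^{MC}_m(U,Y)}\sup_{u\in U}\mathbb{E}[\|u-A_\omega(u)\|_Y]$. *)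

(* Defs.v *)
From HB Require Import structures.
From mathcomp Require Import all_boot all_order all_algebra.
From mathcomp Require Import all_classical all_reals all_analysis.

Set Implicit Arguments.
Unset Strict Implicit.
Unset Printing Implicit Defensive.
Import Order.TTheory GRing.Theory Num.Theory.

Local Open Scope classical_set_scope.
Local Open Scope ring_scope.

Section Defs.
Variable R : realType.

(* Points of R^d are d-tuples of reals (tuples carry the product       *)
(* sigma-algebra in MathComp-Analysis).  The cube [0,1]^d:             *)
Definition cube (d : nat) : set (d.-tuple R) :=
  [set x | forall i : 'I_d, 0 <= tnth x i <= 1].

(* The Lebesgue measure on [0,1]^d, i.e. the uniform probability on the *)
(* cube, built as an iterated product of the uniform probability on     *)
(* [0,1] (= Lebesgue measure restricted to [0,1]).                      *)
Definition tcons (n : nat) (p : R * n.-tuple R) : n.+1.-tuple R :=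
  [tuple of p.1 :: p.2].

Lemma measurable_tcons n : measurable_fun [set: (R * n.-tuple R)%type] (@tcons n).
Proof. exact: (measurable_cons measurable_fst measurable_snd). Qed.

HB.instance Definition _ n :=
  @isMeasurableFun.Build _ _ _ _ (@tcons n) (@measurable_tcons n).

(* identity from the Lebesgue sigma-algebra type to R (same sets) *)
Definition idLR (x : measurableTypeR R) : R := x.
Lemma measurable_idLR : measurable_fun [set: measurableTypeR R] idLR.
Proof. by move=> _ A mA; rewrite setTI. Qed.
HB.instance Definition _ := @isMeasurableFun.Build _ _ _ _ idLR measurable_idLR.

Definition unif01 : probability R R :=
  distribution (uniform_prob (@ltr01 R)) (idLR : {mfun _ >-> _}).

Fixpoint cube_leb (n : nat) : probability (n.-tuple R) R :=
  match n return probability (n.-tuple R) R with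
  | 0 => \d_([tuple] : 0.-tuple R)
  | k.+1 => distribution (unif01 \x cube_leb k)%E
      (@tcons k : {mfun _ >-> _})
  end.

(* The space Y = L^p([0,1]^d), p in [1,+oo] an extended real.          *)
(* Functions on [0,1]^d are represented by functions on d-tuples whose  *)
(* values outside the cube are irrelevant (they are cut off by          *)
(* restriction to the cube, f \_ cube).                                 *)
Definition Lp_norm (d : nat) (p : \bar R) (f : d.-tuple R -> R) : \bar R :=
  Lnorm (cube_leb d) p (fun x => (patch (fun=> 0) (@cube d) f x)%:E).

Definition in_Lp (d : nat) (p : \bar R) (f : d.-tuple R -> R) : Prop :=
  @measurable_fun _ _ (d.-tuple R) R (@cube d) f /\ (Lp_norm p f < +oo)%E.

Definition Lp_open (d : nat) (p : \bar R) (G : set (d.-tuple R -> R)) : Prop :=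
  forall g, in_Lp p g -> G g ->
    exists2 e : R, 0 < e & forall h, in_Lp p h -> (Lp_norm p (fun x => (h x - g x)%R) < e%:E)%E -> G h.

Definition Lp_borel (d : nat) (p : \bar R) : set (set (d.-tuple R -> R)) :=
  <<s Lp_open (d:=d) p >>.

(* C([0,1]^d): continuity on the cube (w.r.t. the max-norm, which induces *)
(* the usual topology of R^d).                                           *)
Definition cont_cube (d : nat) (f : d.-tuple R -> R) : Prop :=
  forall x, @cube d x -> forall e : R, 0 < e ->
    exists2 del : R, 0 < del & forall y, @cube d y ->
      (forall i : 'I_d, `|tnth x i - tnth y i| < del) -> `|f x - f y| < e.

(* Deterministic adaptive methods.  The sampling maps f_1, f_2, ...   *)
(* are encoded by a single map [next] from the information gathered so *)
(* far (the list of pairs (x_j, u(x_j)), j < i) to the next node x_i;   *)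
(* [out] plays the role of Q.                                           *)
Record det_method (d : nat) := DetMethod {
  next : seq (d.-tuple R * R) -> d.-tuple R ;
  out  : seq (d.-tuple R * R) -> (d.-tuple R -> R) }.

Fixpoint info (d : nat) (A : det_method d) (n : nat) (u : d.-tuple R -> R)
    : seq (d.-tuple R * R) :=
  match n with
  | 0 => [::]
  | k.+1 => let h := info A k u in rcons h (next A h, u (next A h))
  end.

Definition run (d : nat) (A : det_method d) (n : nat) (u : d.-tuple R -> R) :=
  out A (info A n u).

Definition is_det_method (d : nat) (p : \bar R) (A : det_method d) : Prop :=
  (forall h, @cube d (next A h)) /\ (forall h, in_Lp p (out A h)).

Definition mc_error (d : nat) (p : \bar R) (U : set (d.-tuple R -> R))
    (dO : measure_display) (Omega : measurableType dO)
    (P : probability Omega R) (A : Omega -> det_method d) (nb : Omega -> nat)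
    : \bar R :=
  ereal_sup [set (\int[P]_w Lp_norm p (fun x => (u x - run (A w) (nb w) u x)%R))%E | u in U].

Definition is_mc_method (d : nat) (p : \bar R) (U : set (d.-tuple R -> R))
    (m : nat) (dO : measure_display) (Omega : measurableType dO)
    (P : probability Omega R) (A : Omega -> det_method d) (nb : Omega -> nat)
    : Prop :=
  [/\ measurable_fun [set: Omega] nb,
      (\int[P]_w (nb w)%:R%:E <= m%:R%:E)%E,
      (forall u, U u -> forall B, Lp_borel p B ->
          measurable [set w | B (run (A w) (nb w) u)]) &
      (forall w, is_det_method p (A w))].

Definition err_MC (d : nat) (p : \bar R) (m : nat) (U : set (d.-tuple R -> R))
    : \bar R :=
  ereal_inf [set e | exists (dO : measure_display) (Omega : measurableType dO)
      (P : probability Omega R) (A : Omega -> det_method d) (nb : Omega -> nat),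
      is_mc_method p U m P A nb /\ e = mc_error p U P A nb].

Definition relu (x : R) : R := Num.max 0 x.

Definition Lambda (M sigma t : R) : R :=
  if t <= sigma - M^-1 then 0 else 1 - M * `|t - sigma|.

Definition theta (d s : nat) (M : R) (y x : d.-tuple R) : R :=
  relu (\sum_(i < d | (i < s)%N) Lambda M (tnth y i) (tnth x i) - (s%:R - 1)).

Definition inv_p (p : \bar R) : R :=
  match p with
  | r%:E => r^-1
  | _ => 0
  end.

End Defs.

(* Main.v *)
Require Import Defs.
From HB Require Import structures.
From mathcomp Require Import all_boot all_order all_algebra.
From mathcomp Require Import all_classical all_reals all_analysis.
From mathcomp Require Import measurable_realfun ess_sup_inf ring lra.
Import Order.TTheory GRing.Theory Num.Theory.
Local Open Scope classical_set_scope.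
Local Open Scope ring_scope.

(** A Bakhvalov-type averaging argument.  With [k = ceil (m^(1/s))], the
    [N = (4k)^s >= 4m] bumps centred at the midpoints of a grid of mesh
    [2/M = 1/(4k)] in the first [s] coordinates have disjoint supports.  A
    method using [n] samples collects the same information on [u0] and on
    [u0 +- h_j] for all but at most [n] indices [j], and for these the two
    errors add up to at least [||2 h_j||_p].  Averaging over [j] and the sign,
    then over the randomness, the error is at least
    [(1 - m/N) ||h_j||_p >= 3/4 ||h_j||_p], and [||h_j||_p] is bounded below on
    the slab where the bump exceeds [1/2]. *)

(** * Boxes, the uniform measure and measurability on the cube *)

Lemma measurable_tuple_box {R : realType} {n} (B : 'I_n -> set R) :
  (forall i, measurable (B i)) ->
  measurable [set x : n.-tuple R | forall i, B i (tnth x i)].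
Proof.
move=> mB.
rewrite (_ : [set x | _] =
    \bigcap_(i in [set: 'I_n]) ((fun x : n.-tuple R => tnth x i) @^-1` B i)).
  apply: fin_bigcap_measurable => //= i _.
  by rewrite -[X in measurable X]setTI; exact: measurable_tnth.
by apply/seteqP; split=> x /= h i => [_|]; exact: h.
Qed.

Lemma measurable_cube (R : realType) n : measurable (@cube R n).
Proof.
have mI : measurable (`[0, 1]%classic : set R) by [].
have := @measurable_tuple_box R n (fun=> `[0, 1]%classic) (fun=> mI).
by congr measurable; apply/seteqP; split=> x /= h i; have := h i; rewrite in_itv.
Qed.

(** Splitting off the head coordinate turns a box into a measurable rectangle, in step with the
    recursion that defines [cube_leb]. *)
Lemma cube_leb_box {R : realType} {n} (B : 'I_n -> set R) :
  (forall i, measurable (B i)) ->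
  cube_leb R n [set x | forall i, B i (tnth x i)] = (\prod_(i < n) unif01 R (B i))%E.
Proof.
elim: n B => [|n IH] B mB.
  by rewrite big_ord0 /= diracE mem_set//= => -[].
have mtl : measurable [set x : n.-tuple R | forall i, B (lift ord0 i) (tnth x i)].
  by apply: (@measurable_tuple_box R n (fun i => B (lift ord0 i))) => i; exact: mB.
rewrite big_ord_recl -IH//.
transitivity ((unif01 R \x cube_leb R n)%E
  (B ord0 `*` [set x | forall i, B (lift ord0 i) (tnth x i)])); last first.
  exact: product_measure1E.
rewrite [LHS]/= /pushforward; congr (_ _); apply/seteqP; split=> -[a x] /=.
  by move=> h; split=> [|i]; [exact: (h ord0)|have := h (lift ord0 i); rewrite tnthS].
move=> [h0 h] i; have [j ->|->] := unliftP ord0 i; last exact: h0.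
by rewrite tnthS; exact: h.
Qed.

Lemma unif01_itv (R : realType) (a b : R) : 0 <= a -> a <= b -> b <= 1 ->
  unif01 R `[a, b]%classic = (b - a)%:E.
Proof.
move=> a0 ab b1; rewrite /unif01 /distribution/= /pushforward /uniform_prob.
rewrite (eq_integral (fun=> 1%E)); last first.
  move=> x; rewrite inE/= /idLR in_itv/= /uniform_pdf => /andP[ax xb].
  by rewrite (le_trans a0 ax) (le_trans xb b1) subr0 invr1.
rewrite (_ : _ @^-1` _ = `[a, b]%classic)// integral_cst//= mul1e.
rewrite lebesgue_measure_itv/= lte_fin EFinN.
case: ltP => // ba.
by rewrite (le_anti (introT andP (conj ab ba))) subrr.
Qed.

(* [{f > a}] is the union of the boxes with rational centre and radius on which
   [f > a], and there are only countably many of these. *)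
Lemma cont_cube_measurable {R : realType} {d} {f : d.-tuple R -> R} :
  cont_cube f -> measurable_fun (@cube R d) f.
Proof.
move=> cf.
apply: (measurability _ (RGenOInfty.measurableE R)) => _ [_ [a ->] <-].
pose box (q : d.-tuple rat * rat) : set (d.-tuple R) :=
  [set x | forall i, `|ratr (tnth q.1 i) - tnth x i| < ratr q.2].
pose F q := if `[< @cube R d `&` box q `<=` [set x | a < f x] >]
  then @cube R d `&` box q else set0.
rewrite (_ : _ `&` _ = \bigcup_q F q).
  apply: countable_bigcupT_measurable => [|q]; first exact: countableP.
  rewrite /F; case: ifP => _ //; apply: measurableI; first exact: measurable_cube.
  apply: (@measurable_tuple_box R d (fun i => [set t | `|ratr (tnth q.1 i) - t| < ratr q.2])).
  move=> i; set c := ratr _; set r := ratr _.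
  rewrite (_ : [set t | _] = `]c - r, c + r[%classic); first exact: measurable_itv.
  by apply/seteqP; split=> t /=; rewrite in_itv/= distrC ltr_distl.
apply/seteqP; split=> x /=; last first.
  move=> [q _]; rewrite /F; case: asboolP => // sub [cx bx].
  by split=> //; rewrite in_itv/= andbT; exact: sub.
rewrite in_itv/= andbT => -[cx afx].
have [e e0 he] := cf x cx (f x - a) (ltac:(by rewrite subr_gt0)).
have [r] := rat_in_itvoo (ltac:(lra) : 0 < e / 2).
rewrite in_itv/= => /andP[r0 re].
have hq i : exists q : rat, `|ratr q - tnth x i| < ratr r.
  have [q] := rat_in_itvoo (ltac:(lra) : tnth x i - ratr r < tnth x i + ratr r).
  by rewrite in_itv/= => /andP[q1 q2]; exists q; rewrite ltr_distl q1 q2.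
pose c := [tuple xget 0%R [set q : rat | `|ratr q - tnth x i| < ratr r] | i < d].
have hc i : `|ratr (tnth c i) - tnth x i| < ratr r.
  by rewrite tnth_mktuple; exact: (xgetPex 0%R (hq i)).
exists (c, r) => //; rewrite /F asboolT//=.
move=> y [cy by_] /=.
suff : `|f x - f y| < f x - a by rewrite ltr_norml => /andP[_ ?]; lra.
apply: he => // i.
apply: le_lt_trans (ler_distD (ratr (tnth c i)) _ _) _.
rewrite distrC; apply: lt_trans (ltrD (hc i) (by_ i)) _; lra.
Qed.

(** * $L^p$ norms on the cube and measurability of the error *)

Lemma measurable_patch_cube {R : realType} {d} {f : d.-tuple R -> R} :
  measurable_fun (@cube R d) f -> measurable_fun setT (patch (fun=> 0) (@cube R d) f).
Proof. by move=> mf; have := (measurable_restrictT f (measurable_cube R d)).1 mf. Qed.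

Lemma Lp_normD {R : realType} {d} {p : \bar R} {f g : d.-tuple R -> R} : (1 <= p)%E ->
  measurable_fun (@cube R d) f -> measurable_fun (@cube R d) g ->
  (Lp_norm p (fun x => (f x + g x)%R) <= Lp_norm p f + Lp_norm p g)%E.
Proof.
move=> p1 mf mg; rewrite /Lp_norm.
have := @eminkowski _ _ _ (cube_leb R d) _ _ p
  (measurable_patch_cube mf) (measurable_patch_cube mg) p1.
apply: le_trans; rewrite le_eqVlt; apply/orP; left; apply/eqP.
by apply: eq_Lnorm => x /=; rewrite /patch; case: ifP => // _; rewrite addr0.
Qed.

Lemma Lp_normN {R : realType} {d} (p : \bar R) (f : d.-tuple R -> R) :
  Lp_norm p (fun x => - f x) = Lp_norm p f.
Proof.
rewrite /Lp_norm -oppe_Lnorm; apply: eq_Lnorm => x /=.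
by rewrite /patch; case: ifP => _; rewrite ?opprK ?oppr0.
Qed.

Lemma eq_Lp_norm {R : realType} {d} (p : \bar R) (f g : d.-tuple R -> R) :
  f =1 g -> Lp_norm p f = Lp_norm p g.
Proof. by move=> /funext ->. Qed.

Lemma Lp_norm_ge0 {R : realType} {d} (p : \bar R) (f : d.-tuple R -> R) :
  (0 <= Lp_norm p f)%E.
Proof. exact: Lnorm_ge0. Qed.

(** A Chebyshev-type bound: only the part of the norm carried by [A] is kept. It covers all [p] at
    once because [inv_p] vanishes at infinity, where only the positivity of [v] matters. *)
Lemma Lp_norm_ge {R : realType} {d} (p : \bar R) (f : d.-tuple R -> R)
    (A : set (d.-tuple R)) (a v : R) : (1 <= p)%E ->
  measurable_fun (@cube R d) f -> measurable A -> A `<=` @cube R d ->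
  0 <= a -> 0 < v -> cube_leb R d A = v%:E ->
  (forall x, A x -> a <= `|f x|) -> ((a * v `^ inv_p p)%:E <= Lp_norm p f)%E.
Proof.
move=> p1 mf mA Acube a0 v0 vA af; rewrite /Lp_norm unlock.
have mpf := measurable_patch_cube mf.
have paf x : A x -> a <= `|patch (fun=> 0) (@cube R d) f x|.
  by move=> Ax; rewrite /patch mem_set ?af//; exact: Acube.
case: p p1 => [r||]//; last first.
  (* For [p = +oo]: if the essential supremum were below [a], then [A] would lie in a null set,
     contradicting [0 < v]. *)
  move=> _; have muT : cube_leb R d setT = 1%E := probability_setT _.
  rewrite [leRHS]/= powRr0 mulr1 ifT; last by rewrite [X in (_ < X)%E]muT lte01.
  rewrite leNgt; apply/negP => lt.
  have := ess_sup_ge (cube_leb R d) (abse \o (fun x => (patch (fun=> 0) (@cube R d) f x)%:E)).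
  move=> [B [mB B0 sB]].
  have /(le_measure (cube_leb R d)) : A `<=` B.
    move=> x Ax; apply: sB => /= le1; have := le_lt_trans le1 lt.
    by rewrite lte_fin ltNge paf.
  rewrite !inE => /(_ mA mB) AB.
  have : (v%:E <= 0)%E by rewrite -vA -B0.
  by rewrite lee_fin leNgt v0.
rewrite lee_fin => r1; have r0 : 0 < r by lra.
(* For finite [p = r], the claim becomes the [r]-th root of the comparison of [a ^ r] times the
   indicator of [A] with [|f| ^ r] under the integral. *)
rewrite /= (_ : a * v `^ r^-1 = (a `^ r * v) `^ r^-1); last first.
  by rewrite powRM ?powR_ge0 ?ltW// -powRrM divff ?gt_eqF// powRr1.
rewrite -poweR_EFin; apply: gt0_ler_poweR; rewrite ?invr_ge0 ?(ltW r0)//.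
- by rewrite in_itv/= leey lee_fin mulr_ge0 ?powR_ge0 ?ltW.
- by rewrite in_itv/= leey andbT; apply: integral_ge0 => x _; rewrite lee_fin powR_ge0.
rewrite EFinM -vA -integral_cst//.
rewrite [leLHS]integral_mkcond.
apply: ge0_le_integral => //.
- by move=> x _; apply: erestrict_ge0 => y _; rewrite lee_fin powR_ge0.
- by exact: (measurable_restrictT _ mA).1 (measurable_cst _).
- apply/measurable_EFinP.
  apply: (@measurableT_comp _ _ _ _ _ _ (fun x => powR x r)) => //=.
  exact: measurableT_comp.
move=> x _; rewrite /patch; case: ifPn => [|_]; last by rewrite lee_fin powR_ge0.
rewrite inE => Ax; rewrite lee_fin; apply: ge0_ler_powR => //.
- exact: ltW.
- exact: paf.
Qed.

(** This links the Borel measurability required of the output to the measurability of the error. The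
    slack [a - ||u - g||] serves as radius around [g], by the triangle inequality. *)
Lemma Lp_open_ball {R : realType} {d} {p : \bar R} {u : d.-tuple R -> R} (a : R) :
  (1 <= p)%E -> measurable_fun (@cube R d) u ->
  Lp_open p [set h | (Lp_norm p (fun x => (u x - h x)%R) < a%:E)%E].
Proof.
move=> p1 mu g [mg _] /= ga.
have gfin : Lp_norm p (fun x => u x - g x) \is a fin_num.
  by rewrite ge0_fin_numE ?Lp_norm_ge0// (lt_trans ga) ?ltry.
exists (a - fine (Lp_norm p (fun x => u x - g x))).
  by rewrite subr_gt0 -lte_fin fineK.
move=> h [mh _] hg /=.
rewrite (@eq_Lp_norm _ _ _ _ (fun x => (u x - g x) + (- (h x - g x)))); last first.
  by move=> x; ring.
apply: le_lt_trans (Lp_normD p1 _ _) _.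
- exact: measurable_funB.
- by apply: measurableT_comp => //; exact: measurable_funB.
rewrite Lp_normN -(fineK gfin); move: hg.
by rewrite EFinB lteBrDl.
Qed.

(** The sublevel sets of the error are preimages, under the random output, of open balls around
    [u]. *)
Lemma measurable_mc_error {R : realType} {d} {p : \bar R} {U : set (d.-tuple R -> R)}
    {m dO} {Omega : measurableType dO} {P : probability Omega R}
    {A : Omega -> det_method R d} {nb : Omega -> nat} {u : d.-tuple R -> R} :
  (1 <= p)%E -> is_mc_method p U m P A nb -> U u -> measurable_fun (@cube R d) u ->
  measurable_fun setT (fun w => Lp_norm p (fun x => (u x - run (A w) (nb w) u x)%R)).
Proof.
move=> p1 [_ _ mA _] Uu mu.
apply: (measurability _ (ErealGenInftyO.measurableE R)) => _ [_ [a ->] <-].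
rewrite setTI.
have /(mA _ Uu) : Lp_borel p
    [set h | (Lp_norm p (fun x => (u x - h x)%R) < a%:E)%E].
  by apply: sub_sigma_algebra; exact: Lp_open_ball.
by congr measurable; apply/seteqP; split=> w /=; rewrite in_itv.
Qed.

(** * Information gathered by a deterministic method *)

Lemma size_info {R : realType} {d} (A : det_method R d) n u : size (info A n u) = n.
Proof. by elim: n => //= n IH; rewrite size_rcons IH. Qed.

Lemma mem_info_cube {R : realType} {d} (A : det_method R d) n u x :
  (forall h, cube (Defs.next A h)) -> x \in map fst (info A n u) -> cube x.
Proof.
move=> cA; elim: n => //= n IH; rewrite map_rcons mem_rcons in_cons.
by case/orP => [/eqP ->|/IH//]; exact: cA.
Qed.

(** Adaptivity does no harm: each node depends only on earlier data, so by induction agreement at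
    the nodes visited for [u] forces the same nodes and values for [v]. *)
Lemma eq_info {R : realType} {d} (A : det_method R d) n u v :
  (forall x, x \in map fst (info A n u) -> v x = u x) -> info A n v = info A n u.
Proof.
elim: n => //= n IH h; rewrite IH => [|x xin]; last first.
  by apply: h; rewrite map_rcons mem_rcons in_cons xin orbT.
by congr (rcons _ (_, _)); apply: h; rewrite map_rcons mem_rcons mem_head.
Qed.

(** Each sample hits at most one index, so a union bound over the samples suffices. *)
Lemma card_hit_le {J : finType} {T : Type} (hit : T -> pred J) (s : seq T) :
  (forall x i j, hit x i -> hit x j -> i = j) ->
  (#|[pred j | has (hit^~ j) s]| <= size s)%N.
Proof.
move=> h1; elim: s => [|x s IH] /=; first by rewrite eq_card0.
apply: leq_trans (leq_add (_ : #|hit x| <= 1)%N IH).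
  rewrite -cardUI; apply: leq_trans (leq_addr _ _).
  by apply/subset_leq_card/fintype.subsetP => j; rewrite !inE.
by rewrite leqNgt; apply/negP => /card_gt1P[i [j [hi hj]]]; rewrite (h1 x i j)// eqxx.
Qed.

(** The at most [n] hit indices are paid for by the term with [n] on the right. Stated this way the
    bound needs no subtraction in the extended reals and is linear in [n], so that it can be
    integrated when [n] is random. *)
Lemma det_lower_bound {R : realType} {d} {p : \bar R} {J : finType}
    {u0 : d.-tuple R -> R} {h : J -> d.-tuple R -> R} {tau : R}
    {A : det_method R d} (n : nat) :
  (1 <= p)%E -> 0 <= tau -> is_det_method p A ->
  (forall j, measurable_fun (@cube R d) (fun x => u0 x + h j x)) ->
  (forall j, measurable_fun (@cube R d) (fun x => u0 x - h j x)) ->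
  (forall x i j, cube x -> h i x != 0 -> h j x != 0 -> i = j) ->
  (forall j, (tau *+ 2)%:E <= Lp_norm p (fun x => h j x *+ 2)%R)%E ->
  ((tau *+ 2 * #|J|%:R)%:E <=
   \sum_(j : J) (Lp_norm p (fun x => u0 x + h j x - run A n (fun x => u0 x + h j x) x)%R
               + Lp_norm p (fun x => u0 x - h j x - run A n (fun x => u0 x - h j x) x)%R)
   + (tau *+ 2)%:E * n%:R%:E)%E.
Proof.
move=> p1 tau0 [cA LA] mP mN disj tauh.
pose S := map fst (info A n u0).
pose hit (x : d.-tuple R) : pred J := [pred j | (x \in S) && (h j x != 0)].
have hitn : (#|[pred j | has (hit^~ j) S]| <= n)%N.
  rewrite -[leqRHS](size_info A n u0) -(size_map fst); apply: card_hit_le => x i j /=.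
  move=> /andP[xS hi] /andP[_ hj]; apply: (disj x) => //.
  exact: mem_info_cube xS.
have Gj j : ~~ has (hit^~ j) S -> ((tau *+ 2)%:E <=
    Lp_norm p (fun x => u0 x + h j x - run A n (fun x => u0 x + h j x) x)%R
    + Lp_norm p (fun x => u0 x - h j x - run A n (fun x => u0 x - h j x) x)%R)%E.
  move=> nhit; have h0 x : x \in S -> h j x = 0.
    move=> xS; apply/eqP; apply: contraNT nhit => hx.
    by apply/hasP; exists x => //; apply/andP.
  rewrite /run !(eq_info A n u0); last 2 first.
  - by move=> x /h0 ->; rewrite subr0.
  - by move=> x /h0 ->; rewrite addr0.
  have [mg _] := LA (info A n u0).
  apply: le_trans (tauh j) _.
  (* Both inputs yield the same output, which cancels together with [u0] in the difference of the
     two errors and leaves [2 h_j]. *)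
  rewrite (@eq_Lp_norm _ _ _ _ (fun x => (u0 x + h j x - out A (info A n u0) x) +
     (- (u0 x - h j x - out A (info A n u0) x)))); last by move=> x; ring.
  rewrite -[X in (_ <= _ + X)%E]Lp_normN; apply: Lp_normD => //.
    exact: measurable_funB.
  by apply: measurableT_comp => //; exact: measurable_funB.
apply: (@le_trans _ _ ((\sum_(j : J) (if has (hit^~ j) S then 0 else tau *+ 2)%:E)
    + (tau *+ 2)%:E * n%:R%:E))%E; last first.
  apply: leeD2r; apply: lee_sum => j _.
  by case: ifPn => [_|/Gj//]; rewrite adde_ge0 ?Lp_norm_ge0.
rewrite sumEFin -EFinM -EFinD lee_fin.
rewrite (eq_bigr (fun j => if ~~ has (hit^~ j) S then tau *+ 2 else 0)); last first.
  by move=> j _; case: ifP.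
rewrite -big_mkcond sumr_const -[X in X + _]mulr_natr -mulrDr -natrD.
rewrite ler_wpM2l ?mulrn_wge0// ler_nat.
rewrite -(cardC [pred j | has (hit^~ j) S]) addnC leq_add//.
Qed.

(** The deterministic bound holds for every [w] with [n = nb w]. Its integral involves [nb] only
    through its mean, which is at most [m], while each of the [2 #|J|] integrated errors is at most
    the worst-case error [E]. *)
Lemma err_MC_ge {R : realType} {d m} {p : \bar R} {J : finType}
    {U : set (d.-tuple R -> R)}
    (u0 : d.-tuple R -> R) (h : J -> d.-tuple R -> R) {tau : R} :
  (1 <= p)%E -> 0 <= tau -> (0 < #|J|)%N ->
  (forall u, U u -> cont_cube u) ->
  (forall j, U (fun x => u0 x + h j x)) ->
  (forall j, U (fun x => u0 x - h j x)) ->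
  (forall x i j, cube x -> h i x != 0 -> h j x != 0 -> i = j) ->
  (forall j, (tau *+ 2)%:E <= Lp_norm p (fun x => h j x *+ 2)%R)%E ->
  (((1 - m%:R / #|J|%:R) * tau)%:E <= err_MC p m U)%E.
Proof.
move=> p1 tau0 J0 Uc UP UN disj tauh.
apply: le_ereal_inf_tmp => _ [dO] [T] [P] [A] [nb] [mcA ->].
have [mnb nbm _ dA] := mcA.
have mU u : U u -> measurable_fun (@cube R d) u by move=> /Uc /cont_cube_measurable.
pose F (u : d.-tuple R -> R) w := Lp_norm p (fun x => u x - run (A w) (nb w) u x)%R.
have F0 u w : (0 <= F u w)%E by exact: Lp_norm_ge0.
have mF u : U u -> measurable_fun setT (F u).
  by move=> Uu; exact: (measurable_mc_error p1 mcA Uu (mU _ Uu)).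
set E := mc_error p U P A nb.
have FE u : U u -> (\int[P]_w F u w <= E)%E.
  by move=> Uu; apply: ereal_sup_ubound; exists u.
pose G j w := (F (fun x => u0 x + h j x)%R w + F (fun x => u0 x - h j x)%R w)%E.
have mG j : measurable_fun setT (G j) by apply: emeasurable_funD; exact: mF.
have G0 j w : (0 <= G j w)%E by rewrite adde_ge0.
have mn : measurable_fun setT (fun w => (nb w)%:R%:E : \bar R).
  apply/measurable_EFinP.
  by apply: (@measurableT_comp _ _ _ _ _ _ (fun n => n%:R : R)).
have key : ((tau *+ 2 * #|J|%:R)%:E <=
    \sum_(j : J) \int[P]_w G j w + (tau *+ 2)%:E * \int[P]_w (nb w)%:R%:E)%E.
  rewrite -ge0_integral_sum// -ge0_integralZl//; last by rewrite lee_fin mulrn_wge0.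
  rewrite -ge0_integralD//; last 4 first.
  - by move=> w _; apply: sume_ge0.
  - exact: emeasurable_sum.
  - by move=> w _; rewrite -EFinM lee_fin mulr_ge0// mulrn_wge0.
  - exact: measurable_funeM.
  rewrite -[leLHS]mule1 -(@probability_setT _ _ _ P) -integral_cst//.
  apply: ge0_le_integral => //.
  - by move=> w _; rewrite lee_fin mulr_ge0// mulrn_wge0.
  - apply: emeasurable_funD; first exact: emeasurable_sum.
    exact: measurable_funeM.
  move=> w _; apply: det_lower_bound => // j; exact: mU.
have GE j : (\int[P]_w G j w <= E + E)%E.
  have -> : (\int[P]_w G j w = \int[P]_w F (fun x => u0 x + h j x)%R w +
      \int[P]_w F (fun x => u0 x - h j x)%R w)%E.
    by apply: ge0_integralD => //; exact: mF.
  by apply: leeD; exact: FE.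
have E0 : (0 <= E)%E.
  have /card_gt0P[j0 _] := J0.
  by apply: le_trans (FE _ (UP j0)); exact: integral_ge0.
(* If [E] is infinite the claim is trivial; otherwise everything becomes an inequality between
   reals. *)
case: E E0 GE {FE} => [e||]// e0 GE; last by rewrite leey.
have {key} : ((tau *+ 2 * #|J|%:R)%:E <= ((e + e) *+ #|J| + tau *+ 2 * m%:R)%:E)%E.
  apply: le_trans key _; rewrite [leRHS]EFinD; apply: leeD.
    rewrite -[leRHS]/(_%:E) -sumr_const -sumEFin; apply: lee_sum => j _.
    by rewrite EFinD.
  by rewrite EFinM; apply: lee_wpmul2l => //; rewrite lee_fin mulrn_wge0.
rewrite !lee_fin -mulr_natr => key.
have N0 : 0 < #|J|%:R :> R by rewrite ltr0n.
rewrite -(ler_pM2r N0).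
rewrite (_ : _ * tau * _ = tau * #|J|%:R - tau * m%:R); last first.
  by field; rewrite gt_eqF.
move: key; rewrite !mulr2n; lra.
Qed.

(** * Support, height and norm of the bumps *)

Lemma Lambda_le1 {R : realType} (M sigma t : R) : 0 < M -> Lambda M sigma t <= 1.
Proof.
move=> M0; rewrite /Lambda; case: ifP => // _.
by rewrite lerBlDr lerDl mulr_ge0// ltW.
Qed.

Lemma Lambda_gt0 {R : realType} (M sigma t : R) : 0 < M ->
  0 < Lambda M sigma t -> `|t - sigma| < M^-1.
Proof.
move=> M0; rewrite /Lambda; case: ifP => [_|_]; first by rewrite ltxx.
by rewrite subr_gt0 -ltr_pdivlMl// mulr1.
Qed.

Lemma Lambda_ge {R : realType} (M sigma t : R) : 0 < M ->
  1 - M * `|t - sigma| <= Lambda M sigma t.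
Proof.
move=> M0; rewrite /Lambda; case: ifP => // ts.
rewrite subr_le0 -ler_pdivrMl// mulr1 distrC.
by apply: le_trans (ler_norm _); lra.
Qed.

(** Where the bump is nonzero, the deficits [1 - Lambda], all nonnegative, sum to less than 1. Hence
    each is below 1 and each [Lambda] is positive. *)
Lemma theta_neq0 {R : realType} {d s} {M : R} {y x : d.-tuple R} (i : 'I_d) :
  (s <= d)%N -> 0 < M -> theta s M y x != 0 -> (i < s)%N ->
  `|tnth x i - tnth y i| < M^-1.
Proof.
move=> sd M0 th si; apply: Lambda_gt0 => //.
have : \sum_(j < d | (j < s)%N) (1 - Lambda M (tnth y j) (tnth x j)) < 1.
  rewrite sumrB -(big_ord_widen d (fun=> 1 : R) sd) sumr_const card_ord.
  suff : 0 < \sum_(j < d | (j < s)%N) Lambda M (tnth y j) (tnth x j) - (s%:R - 1) by lra.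
  by rewrite ltNge; apply: contraNN th => h; rewrite /theta /relu max_l.
rewrite (bigD1 i)//=.
have : 0 <= \sum_(j < d | (j < s)%N && (j != i)) (1 - Lambda M (tnth y j) (tnth x j)).
  by apply: sumr_ge0 => j _; rewrite subr_ge0 Lambda_le1.
by lra.
Qed.

Lemma theta_ge {R : realType} {d s} {M delta : R} {y x : d.-tuple R} :
  (s <= d)%N -> 0 < M ->
  (forall i : 'I_d, (i < s)%N -> `|tnth x i - tnth y i| <= delta) ->
  1 - s%:R * (M * delta) <= theta s M y x.
Proof.
move=> sd M0 xy.
have : \sum_(j < d | (j < s)%N) (1 - M * delta) <=
    \sum_(j < d | (j < s)%N) Lambda M (tnth y j) (tnth x j).
  apply: ler_sum => j js; apply: le_trans (Lambda_ge _ _ _ M0).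
  by rewrite lerB// ler_pM2l// xy.
rewrite -(big_ord_widen d (fun=> 1 - M * delta) sd) sumr_const card_ord -mulr_natr.
rewrite /theta /relu => h; apply: (@le_trans _ _
  (\sum_(i < d | (i < s)%N) Lambda M (tnth y i) (tnth x i) - (s%:R - 1))); first lra.
by rewrite le_max lexx orbT.
Qed.

(** The slab has side [2 delta] around [y] in the first [s] coordinates and the full side [[0, 1]]
    in the others, where the bump is constant. *)
Lemma cube_leb_slab {R : realType} {d s} {delta : R} {y : d.-tuple R} :
  (s <= d)%N -> 0 <= delta ->
  (forall i : 'I_d, (i < s)%N -> delta <= tnth y i <= 1 - delta) ->
  exists A : set (d.-tuple R), [/\ measurable A, A `<=` @cube R d,
    cube_leb R d A = ((delta *+ 2) ^+ s)%:E &
    forall x, A x -> forall i : 'I_d, (i < s)%N -> `|tnth x i - tnth y i| <= delta].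
Proof.
move=> sd d0 yd.
pose B (i : 'I_d) : set R := if (i < s)%N
  then `[tnth y i - delta, tnth y i + delta]%classic else `[0, 1]%classic.
have mB i : measurable (B i) by rewrite /B; case: ifP.
exists [set x | forall i, B i (tnth x i)]; split.
- exact: measurable_tuple_box.
- move=> x /= xB i; have := xB i; rewrite /B; case: ifPn => [/yd|_]/=.
    by rewrite in_itv/=; lra.
  by rewrite in_itv.
- rewrite cube_leb_box//.
  rewrite (eq_bigr (fun i : 'I_d => (if (i < s)%N then delta *+ 2 else 1)%:E)).
    rewrite -(big_morph EFin EFinM erefl) -big_mkcond.
    by rewrite -(big_ord_widen d (fun=> delta *+ 2) sd) prodr_const card_ord.
  move=> i _; rewrite /B; case: ifPn => [/yd /andP[? ?]|_].
    by rewrite unif01_itv; [congr EFin; rewrite mulr2n; ring|lra|lra|lra].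
  by rewrite unif01_itv// subr0.
move=> x /= xB i si; have := xB i; rewrite /B si /= in_itv/= => ?.
by rewrite ler_distl.
Qed.

Lemma inv_p_ge0 {R : realType} (p : \bar R) : (1 <= p)%E -> 0 <= inv_p p.
Proof. by case: p => //= r; rewrite lee_fin invr_ge0; lra. Qed.

Lemma Lp_norm_theta_ge {R : realType} {d s} {M c : R} {p : \bar R} {y : d.-tuple R} :
  (1 <= p)%E -> (0 < s <= d)%N -> 0 < M -> 0 <= c ->
  measurable_fun (@cube R d) (fun x => c * theta s M y x) ->
  (forall i : 'I_d, (i < s)%N -> M^-1 <= tnth y i <= 1 - M^-1) ->
  ((c / 2 * (M * s%:R) `^ (- (s%:R * inv_p p)))%:E <=
    Lp_norm p (fun x => (c * theta s M y x)%R))%E.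
Proof.
move=> p1 /andP[s0 sd] M0 c0 mth yM.
have s0' : 1 <= s%:R :> R by rewrite ler1n.
have Ms0 : 0 < M * s%:R by rewrite mulr_gt0//; lra.
(* With this choice [s * M * delta = 1/2], so the bump is at least [1/2] on the slab, whose volume
   is [(M * s) ^- s]. *)
pose delta := (M * s%:R)^-1 / 2.
have d0 : 0 < delta by rewrite divr_gt0 ?invr_gt0.
have dM : delta <= M^-1.
  rewrite /delta invfM -mulrA ger_pMr ?invr_gt0// -invfM invf_le1; lra.
have [|A [mA Acube muA Ay]] := @cube_leb_slab R d s delta y sd (ltW d0).
  by move=> i /yM /andP[? ?]; apply/andP; split; lra.
have -> : (M * s%:R) `^ (- (s%:R * inv_p p)) = ((delta *+ 2) ^+ s) `^ inv_p p.
  have -> : delta *+ 2 = (M * s%:R)^-1 by rewrite /delta mulr2n; lra.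
  rewrite -powR_mulrn ?invr_ge0 ?ltW//.
  by rewrite -powR_inv1 ?ltW// -!powRrM; congr (_ `^ _); ring.
apply: (@Lp_norm_ge _ _ _ _ A _ _ p1 mth mA Acube _ _ muA).
- by rewrite divr_ge0.
- by rewrite exprn_gt0// mulrn_wgt0.
move=> x /Ay /(theta_ge sd M0).
rewrite (_ : _ * (_ * _) = 2^-1); last first.
  by rewrite /delta; field; rewrite !gt_eqF//; lra.
move=> th; rewrite ger0_norm; last by rewrite mulr_ge0//; lra.
by rewrite ler_wpM2l//; lra.
Qed.

(** * Arithmetic of the constants *)

(** Put [e = 1 + s q]. Since [k <= 2 T], the factor [(8 k s) ^ e] is at most [(16 s) ^ e * T ^ e],
    and [T ^ e] is the required power of [m]. Passing from 16 to 64 gains [4 ^ e >= 4], more than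
    enough to absorb the factor [1 - m / N >= 3/4]. *)
Lemma bound_constants {R : realType} {m s k : nat} {lam q : R} :
  (0 < m)%N -> (0 < s)%N -> 0 < lam -> 0 <= q ->
  (m%:R `^ s%:R^-1 <= k%:R :> R) -> (k%:R <= m%:R `^ s%:R^-1 *+ 2 :> R) ->
  lam / 2 / (64 * s%:R) `^ (1 + s%:R * q) * m%:R `^ (- q - s%:R^-1) <=
  (1 - m%:R / ((4 * k) ^ s)%:R) *
    (lam / (8 * k%:R * s%:R) / 2 * (8 * k%:R * s%:R) `^ (- (s%:R * q))).
Proof.
move=> m0 s0 lam0 q0; set T := m%:R `^ _ => Tk kT.
have s0' : 1 <= s%:R :> R by rewrite ler1n.
have m1 : 1 <= m%:R :> R by rewrite ler1n.
have T0 : 0 < T by rewrite powR_gt0; lra.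
have k0 : 0 < k%:R :> R by lra.
have Ts : T ^+ s = m%:R.
  by rewrite -powR_mulrn ?ltW// -powRrM mulVf ?powRr1//; lra.
(* Here [4 ^ s >= 4] because [s >= 1], and [k ^ s >= T ^ s = m]. *)
have N4m : 4 * m%:R <= ((4 * k) ^ s)%:R :> R.
  rewrite natrX natrM exprMn ler_pM//.
    by case: s s0 {s0' T Tk kT T0 Ts} => // s _; rewrite ler_eXnr// ler1n.
  by rewrite -Ts lerXn2r ?nnegrE// ltW.
set N : R := ((4 * k) ^ s)%:R in N4m *.
set e := 1 + s%:R * q.
have e1 : 1 <= e by rewrite lerDl mulr_ge0//; lra.
set X := (8 * k%:R * s%:R) `^ e.
have Ms0 : 0 < 8 * k%:R * s%:R :> R by rewrite !mulr_gt0//; lra.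
have X0 : 0 < X by rewrite powR_gt0.
have -> : lam / (8 * k%:R * s%:R) / 2 * (8 * k%:R * s%:R) `^ (- (s%:R * q)) = lam / 2 / X.
  have -> : X^-1 = (8 * k%:R * s%:R)^-1 * (8 * k%:R * s%:R) `^ (- (s%:R * q)).
    rewrite -powRN -powR_inv1 ?ltW// -powRD; last by apply/implyP => _; rewrite gt_eqF.
    by congr (_ `^ _); rewrite /e; ring.
  by ring.
have -> : m%:R `^ (- q - s%:R^-1) = (T `^ e)^-1.
  rewrite -powRN -powRrM; congr (_ `^ _); rewrite /e; field.
  by rewrite gt_eqF//; lra.
set Z := T `^ e; have Z0 : 0 < Z by rewrite powR_gt0.
set W : R := (16 * s%:R) `^ e; have W0 : 0 < W by rewrite powR_gt0//; lra.
have XWZ : X <= W * Z.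
  rewrite -powRM; [|lra|lra].
  apply: ge0_ler_powR; rewrite ?nnegrE; [lra|exact: ltW|nra|].
  by rewrite -mulr_natr in kT; nra.
set Y : R := (64 * s%:R) `^ e.
have YW : 4 * W <= Y.
  rewrite /Y (_ : 64 * s%:R = 4 * (16 * s%:R)); last by ring.
  rewrite powRM; [|lra|lra].
  rewrite ler_pM2r// -[leLHS]powRr1; [|lra].
  by rewrite ler_powR//; lra.
have N0 : 0 < N by lra.
have mN : 3 / 4 <= 1 - m%:R / N.
  suff : m%:R / N <= 1 / 4 by lra.
  by rewrite ler_pdivrMr//; lra.
apply: (@le_trans _ _ (3 / 4 * (lam / 2 / X))); last first.
  by rewrite ler_wpM2r// !divr_ge0 ?ltW.
apply: (@le_trans _ _ (lam / 2 / (4 * W) / Z)).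
  rewrite ler_pM2r ?invr_gt0// ler_pM2l; last by lra.
  by rewrite lef_pV2// posrE; lra.
rewrite (_ : lam / 2 / (4 * W) / Z = 1 / 4 * (lam / 2 / (W * Z))); last first.
  by field; rewrite !gt_eqF.
apply: ler_pM; [lra| |lra|].
  by rewrite !divr_ge0 ?mulr_ge0 ?ltW.
rewrite ler_pM2l; last by lra.
by rewrite lef_pV2// posrE mulr_gt0.
Qed.

(** * The grid of bumps and the final estimate *)

Theorem theorem2p6 (R : realType) (d m s : nat)
    (hm : (0 < m)%N) (hs1 : (1 <= s)%N) (hsd : (s <= d)%N)
    (U : set (d.-tuple R -> R)) (lam : R) (u0 : d.-tuple R -> R) :
  let M : R := 8 * (Num.ceil ((m%:R : R) `^ (s%:R)^-1))%:~R in
  (forall u, U u -> cont_cube u) ->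
  0 < lam -> cont_cube u0 ->
  (forall (nu : R), nu = 1 \/ nu = -1 -> forall y : d.-tuple R, cube y ->
     U (fun x => u0 x + nu * (lam / (M * s%:R)) * theta s M y x)) ->
  forall p : \bar R, (1 <= p)%E ->
    ((((lam / 2) / ((64 * s%:R) `^ (1 + s%:R * inv_p p)))
       * (m%:R `^ (- inv_p p - (s%:R)^-1)))%:E <= err_MC p m U)%E.
Proof.
move=> M Uc lam0 _ HU p p1.
set T : R := m%:R `^ s%:R^-1 in M HU *.
have T1 : 1 <= T.
  by rewrite -[leLHS](@powRr0 _ m%:R) ler_powR ?ler1n// invr_ge0.
pose k := `|Num.ceil T|%N.
have kE : (Num.ceil T)%:~R = k%:R :> R.
  by rewrite natr_absz ger0_norm// ceil_ge0; lra.
have Tk : T <= k%:R by rewrite -kE ceil_ge.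
(* The ceiling is below [T + 1], and [T >= 1]. *)
have kT : k%:R <= T *+ 2.
  by have := ceilB1_lt T; rewrite intrB kE mulr2n; lra.
have k0 : 0 < k%:R :> R by lra.
have ME : M = 8 * k%:R by rewrite /M kE.
have M0 : 0 < M by rewrite ME; lra.
have s1 : 1 <= s%:R :> R by rewrite ler1n.
pose c := lam / (M * s%:R).
have c0 : 0 < c by rewrite divr_gt0// mulr_gt0//; lra.
pose J : finType := {ffun 'I_s -> 'I_(4 * k)}.
(* In the first [s] coordinates the centres are the midpoints of the cells
   [[2 j / M, (2 j + 2) / M]], which fill [[0, 1]] as [M = 8 k]. The other coordinates do not affect
   [theta]; [1/2] keeps the centre in the cube. *)
pose ctr (j : J) : d.-tuple R :=
  [tuple if insub (val i) is Some i' then (2 * (j i')%:R + 1) / M else 2^-1 | i < d].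
have ctrE (j : J) (i : 'I_s) : tnth (ctr j) (widen_ord hsd i) = (2 * (j i)%:R + 1) / M.
  by rewrite tnth_mktuple (valK i).
have ctrM (j : J) (i : 'I_d) : (i < s)%N -> M^-1 <= tnth (ctr j) i <= 1 - M^-1.
  move=> si; have -> : i = widen_ord hsd (Ordinal si) by apply/val_inj.
  rewrite ctrE; set t := j _.
  have tk : t%:R + 1 <= 4 * k%:R :> R by have := ltn_ord t; rewrite -(ler_nat R) natrM -natr1.
  apply/andP; split.
    by rewrite -[leLHS]mul1r ler_pM2r ?invr_gt0// lerDr mulr_ge0.
  have -> : 1 - M^-1 = (M - 1) / M by field; rewrite gt_eqF.
  by rewrite ler_pM2r ?invr_gt0// ME; lra.
have ctrC j : cube (ctr j).
  move=> i; have [si|si] := ltnP i s.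
    have := ctrM j i si; have : 0 < M^-1 by rewrite invr_gt0.
    by move=> ? /andP[? ?]; apply/andP; split; lra.
  rewrite tnth_mktuple insubN -?leqNgt//.
  by apply/andP; split; lra.
pose h (j : J) x := c * theta s M (ctr j) x.
have UP j : U (fun x => u0 x + h j x).
  have := HU 1 (or_introl erefl) _ (ctrC j).
  by congr U; apply/funext => x; rewrite /h mul1r.
have UN j : U (fun x => u0 x - h j x).
  have := HU (-1) (or_intror erefl) _ (ctrC j).
  by congr U; apply/funext => x; rewrite /h /c; ring.
have cardJ : #|J| = ((4 * k) ^ s)%N by rewrite card_ffun !card_ord.
(* A common point puts the two centres at distance below [2 / M] in each of the first [s]
   coordinates, so the integer grid indices differ by less than 1. *)
have inj x i j : cube x -> h i x != 0 -> h j x != 0 -> i = j.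
  move=> _; rewrite !mulf_eq0 !negb_or => /andP[_ ti] /andP[_ tj].
  apply/ffunP => l; apply/val_inj => /=.
  have := theta_neq0 (widen_ord hsd l) hsd M0 ti (ltn_ord l).
  have := theta_neq0 (widen_ord hsd l) hsd M0 tj (ltn_ord l).
  rewrite !ctrE; set a := tnth x _; set b := i l; set e := j l.
  rewrite !ltr_distl => /andP[e1 e2] /andP[b1 b2].
  have lt1 : (2 * b%:R + 1 - 1) / M < (2 * e%:R + 1 + 1) / M
    by rewrite !(mulrDl _ _ M^-1) mulNr mul1r; lra.
  have lt2 : (2 * e%:R + 1 - 1) / M < (2 * b%:R + 1 + 1) / M
    by rewrite !(mulrDl _ _ M^-1) mulNr mul1r; lra.
  move: lt1 lt2; rewrite !ltr_pM2r ?invr_gt0// => lt1 lt2.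
  have be : (b < e.+1)%N by rewrite -(ltr_nat R) -natr1; lra.
  have eb : (e < b.+1)%N by rewrite -(ltr_nat R) -natr1; lra.
  by apply/eqP; rewrite eqn_leq; apply/andP; split; [exact: be|exact: eb].
pose tau := c / 2 * (M * s%:R) `^ (- (s%:R * inv_p p)).
(* Measurability of the bump comes from the members of [U]: [2 h_j] is the difference of the
   continuous functions [u0 + h_j] and [u0 - h_j]. *)
have mh j : measurable_fun (@cube R d) (fun x => (c *+ 2) * theta s M (ctr j) x).
  have mP := cont_cube_measurable (Uc _ (UP j)).
  have mN := cont_cube_measurable (Uc _ (UN j)).
  have := measurable_funB mP mN; congr measurable_fun; apply/funext => x /=.
  by rewrite /h; ring.
have tauh j : ((tau *+ 2)%:E <= Lp_norm p (fun x => h j x *+ 2)%R)%E.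
  rewrite (@eq_Lp_norm _ _ _ _ (fun x => (c *+ 2) * theta s M (ctr j) x)); last first.
    by move=> x; rewrite /h; ring.
  rewrite (_ : tau *+ 2 = (c *+ 2) / 2 * (M * s%:R) `^ (- (s%:R * inv_p p))); last first.
    by rewrite /tau; ring.
  apply: Lp_norm_theta_ge => //; [by rewrite hs1|by rewrite mulrn_wge0// ltW|exact: ctrM].
apply: le_trans (err_MC_ge u0 h p1 _ _ Uc UP UN inj tauh).
- rewrite lee_fin cardJ /tau /c ME.
  exact: (bound_constants hm hs1 lam0 (inv_p_ge0 _ p1) Tk kT).
- by rewrite /tau mulr_ge0 ?powR_ge0// divr_ge0// ltW.
- have kn : (0 < k)%N by move: k0; rewrite ltr0n.
  by rewrite cardJ expn_gt0 muln_gt0 kn.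
Qed.
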